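(* Let $G=(V_G,E_G)$ be a finite simple graph and let $H=(V_H,E_H)$ be a path-intersecting subgraph of $G$. Then the chromatic polynomial $\chi(H,t)$ divides the chromatic polynomial $\chi(G,t)$ (in $\mathbb{Z}[t]$).
   Context: All graphs are non-empty, finite, undirected and simple. The chromatic polynomial $\chi(G,t)$ of a graph $G$ is the polynomial such that for every integer $k\ge 0$, $\chi(G,k)$ is the number of proper colorings of $G$ with $k$ colors (assignments of one of $k$ colors to each vertex such that adjacent vertices get different colors). A subgraph $H=(V_H,E_H)$ of $G$ is called path-intersecting if for every pair of vertices $v_i,v_j\in V_H$ that are non-adjacent in $H$, there is no path $P=(V_P,E_P)$ in $G$ between $v_i$ and $v_j$ such that $E_H\cap E_P=\emptyset$ and $V_H\cap V_P=\{v_i,v_j\}$. *)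

(* Defs.v *)
From mathcomp Require Import all_boot all_order all_algebra.

Set Implicit Arguments.
Unset Strict Implicit.
Unset Printing Implicit Defensive.

Import GRing.Theory Num.Theory.

(* Graphs live inside an ambient finite type [T], so that the vertices of a   *)
(* subgraph are literally vertices of the larger graph. An edge is a          *)
(* two-element set of vertices.                                               *)
Record graph (T : finType) := Graph {
  vertices : {set T};
  edges : {set {set T}};
  vertices_neq0 : vertices != set0;
  edgesP : forall e, e \in edges -> (e \subset vertices) && (#|e| == 2) }.

Definition adj (T : finType) (G : graph T) : rel T :=
  fun x y => [set x; y] \in edges G.

Definition subgraph (T : finType) (H G : graph T) : bool :=
  (vertices H \subset vertices G) && (edges H \subset edges G).

(* A path is given by its initial vertex [x] and the sequence [p] of its      *)
(* remaining vertices; paths do not repeat vertices.                          *)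
Definition path_between (T : finType) (G : graph T) (x y : T) (p : seq T) :=
  [&& x \in vertices G, path (adj G) x p, uniq (x :: p) & last x p == y].

Definition path_vertices (T : finType) (x : T) (p : seq T) : {set T} :=
  [set z in x :: p].

Definition path_edges (T : finType) (x : T) (p : seq T) : {set {set T}} :=
  [set [set z.1; z.2] | z in zip (x :: p) p].

(* The two vertices must be distinct: a vertex is not adjacent to itself, and *)
(* the trivial path at it would otherwise always be a forbidden one.          *)
Definition path_intersecting (T : finType) (H G : graph T) : Prop :=
  forall x y : T, x \in vertices H -> y \in vertices H -> x != y ->
    ~~ adj H x y ->
    ~ exists p : seq T,
        [/\ path_between G x y p,
            edges H :&: path_edges x p = set0
          & vertices H :&: path_vertices x p = [set x; y]].

Definition proper_colorings (T : finType) (G : graph T) (k : nat) :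
    {set {ffun {x : T | x \in vertices G} -> 'I_k}} :=
  [set f : {ffun {x : T | x \in vertices G} -> 'I_k}
     | [forall u, forall v, adj G (val u) (val v) ==> (f u != f v)]].

Local Open Scope ring_scope.

Lemma card_ffun_idem (S : finType) (r : S -> S) (k : nat) :
  (forall x, r (r x) = r x) ->
  #|[set f : {ffun S -> 'I_k} | [forall x, f (r x) == f x]]|
    = (k ^ #|{: {x : S | r x == x}}|)%N.
Proof.
move=> rK.
have rP x : r (r x) == r x by rewrite rK.
pose ext (h : {ffun {x : S | r x == x} -> 'I_k}) : {ffun S -> 'I_k} :=
  [ffun x => h (exist _ (r x) (rP x))].
have ext_inj : injective ext.
  move=> h1 h2 /ffunP eq_h; apply/ffunP => u.
  have := eq_h (val u); rewrite !ffunE.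
  suff -> : exist _ (r (val u)) (rP (val u)) = u by [].
  by apply: val_inj => /=; apply/eqP; exact: valP u.
rewrite -[in RHS](card_ord k) -card_ffun -(card_imset predT ext_inj).
apply: eq_card => f; rewrite inE; apply/forallP/imsetP => [rf | [h _ ->] x].
  exists [ffun u => f (val u)] => //; apply/ffunP => x.
  by rewrite !ffunE /=; apply/esym/eqP.
by rewrite !ffunE; apply/eqP; congr (h _); apply: val_inj => /=.
Qed.

Lemma constrained_colorings_poly (S : finType) (s t : seq (S * S)) :
  {p : {poly int} | forall k : nat, p.[k%:Z] =
     #|[set f : {ffun S -> 'I_k} | all (fun z => f z.1 != f z.2) s
                                & all (fun z => f z.1 == f z.2) t]|%:Z}.
Proof.
elim: s t => [|a s IHs] t; last first.
  have [p pE] := IHs t; have [q qE] := IHs (a :: t).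
  exists (p - q) => k; rewrite hornerD hornerN pE qE.
  set A := [set f | _ & _]; set B := [set f | _ & _]; set C := [set f | _ & _].
  suff -> : #|A| = (#|B| + #|C|)%N by rewrite PoszD addrC addKr.
  rewrite -(cardsID [set f : {ffun S -> 'I_k} | f a.1 == f a.2] A).
  by congr (_ + _)%N; apply: eq_card => f; rewrite !inE /=;
    case: (_ == _); rewrite ?andbT ?andbF.
pose e : rel S := fun x y => ((x, y) \in t) || ((y, x) \in t).
have e_sym : connect_sym e.
  by apply: sym_connect_sym => x y; rewrite /e orbC.
exists ('X ^+ #|{: {x : S | fingraph.root e x == x}}|) => k.
rewrite hornerXn -[k%:Z]natz -natrX natz -card_ffun_idem; last exact: fingraph.root_root.
congr (_%:Z); apply: eq_card => f; rewrite !inE /=.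
apply/forallP/allP => [fr [x y] t_xy | ft x].
  rewrite /= -(eqP (fr x)) -(eqP (fr y)); apply/eqP; congr (f _).
  by apply/fingraph.rootP => //; apply: connect1; rewrite /e t_xy.
have /connectP[p e_p ->] := connect_root e x.
elim: p x e_p => //= y p IHp x /andP[e_xy e_p].
rewrite (eqP (IHp y e_p)).
by case/orP: e_xy => /ft /=; rewrite // eq_sym.
Qed.

Lemma chromatic_poly_sig (T : finType) (G : graph T) :
  {p : {poly int} | forall k : nat, p.[k%:Z] = #|proper_colorings G k|%:Z}.
Proof.
pose V := {x : T | x \in vertices G}.
pose s := [seq z <- enum {: V * V} | adj G (val z.1) (val z.2)].
have [p pE] := constrained_colorings_poly s [::].
exists p => k; rewrite pE; congr (_%:Z); apply: eq_card => f.
rewrite !inE /= andbT; apply/allP/forallP => [fs u | fG [u v]].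
  apply/forallP => v; apply/implyP => uv.
  by apply: (fs (u, v)); rewrite mem_filter /= uv mem_enum.
by rewrite mem_filter => /andP[/= uv _]; move/forallP: (fG u) => /(_ v)/implyP->.
Qed.

Definition chromatic_poly (T : finType) (G : graph T) : {poly int} :=
  sval (chromatic_poly_sig G).

Lemma chromatic_polyE (T : finType) (G : graph T) (k : nat) :
  (chromatic_poly G).[k%:Z] = #|proper_colorings G k|%:Z.
Proof. exact: svalP (chromatic_poly_sig G) k. Qed.

Lemma chromatic_poly_unique (T : finType) (G : graph T) (p : {poly int}) :
  (forall k : nat, p.[k%:Z] = #|proper_colorings G k|%:Z) ->
  p = chromatic_poly G.
Proof.
move=> pE; apply/eqP; rewrite -subr_eq0; apply/negPn/negP => q_neq0.
set q := p - _ in q_neq0.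
have := @max_poly_roots _ q [seq k%:Z | k <- iota 0 (size q)] q_neq0.
rewrite size_map size_iota ltnn => q_roots.
apply/notF/q_roots; last by rewrite map_inj_uniq ?iota_uniq // => ? ? [].
apply/allP => _ /mapP[k _ ->].
by rewrite /root hornerD hornerN pE chromatic_polyE subrr.
Qed.

(* Main.v *)
(* Path-intersecting means that every component of G - V(H) attaches to a     *)
(* clique of H, and that H is induced. Two proper k-colourings c, c' of H are *)
(* both injective on such a clique, so permuting colours separately on each   *)
(* component matches the extensions of c with those of c'. Hence chi(H,k)     *)
(* divides chi(G,k) for every natural k. Since chi(H) is monic, this lifts to *)
(* polynomials: the remainder of chi(G) by chi(H) takes values divisible by   *)
(* chi(H,k) but eventually smaller, so it has infinitely many roots.          *)

Require Import Defs.
From mathcomp Require Import all_boot all_order all_fingroup all_algebra.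

Set Implicit Arguments.
Unset Strict Implicit.
Unset Printing Implicit Defensive.

Import Order.TTheory GRing.Theory Num.Theory.

Local Open Scope ring_scope.

(** Proper [k]-colourings of [G] are partitioned by their restriction to [H]. All fibres have equal
    size ([leq_card_extensions], used in both directions), whence [card_proper_colorings_dvd]. The
    graph-theoretic input is [connect_attach_adj]: two vertices of [H] attached to one component of
    [G - V(H)] are joined by a path through it, hence adjacent in [H]. Divisibility of values alone
    does not give divisibility in Z[t]; monicity ([chromatic_poly_monic]) allows division with
    remainder over the integers, and [poly_dvd_of_horner_dvd] kills the remainder by growth. *)

(** * Growth of integer polynomials and divisibility from values *)

(** Multiplying by [x] avoids the exponent [m - 1], so [m = 0] is no special case; [A] is the sum of
    the absolute values of the coefficients. *)
Lemma horner_le_exp (p : {poly int}) (m : nat) : (size p <= m)%N ->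
  exists A : int, forall x : int, 1 <= x -> `|p.[x]| * x <= A * x ^+ m.
Proof.
move=> szp; exists (\sum_(i < m) `|p`_i|) => x x1.
have x0 : 0 <= x by apply: le_trans x1.
rewrite (horner_coef_wide x szp).
apply: le_trans (ler_wpM2r x0 (ler_norm_sum _ _ _)) _.
rewrite !mulr_suml; apply: ler_sum => i _.
rewrite normrM -mulrA ler_wpM2l // normrX ger0_norm // -exprSr.
by rewrite ler_weXn2l.
Qed.

(** Split off the leading term of [q]: its integer coefficient has absolute value at least 1, so
    once [k] exceeds [A + B] it outweighs [p] and the lower terms of [q] together. *)
Lemma eventually_ltr_horner (p q : {poly int}) : (size p < size q)%N ->
  exists K : nat, forall k : nat, (K < k)%N -> `|p.[k%:Z]| < `|q.[k%:Z]|.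
Proof.
move=> szpq; have q0 : q != 0 by rewrite -size_poly_gt0 (leq_ltn_trans _ szpq).
pose m := (size q).-1; have szq : size q = m.+1 by rewrite /m prednK ?size_poly_gt0.
pose a := lead_coef q; pose r := q - a *: 'X^m.
have szr : (size r <= m)%N.
  apply/leq_sizeP => j; rewrite coefB coefZ coefXn leq_eqVlt => /orP[/eqP<-|mj].
    by rewrite eqxx mulr1 subrr.
  by rewrite nth_default ?szq // gtn_eqF // mulr0 subr0.
have szp : (size p <= m)%N by rewrite -ltnS -szq.
have [A pA] := horner_le_exp szp; have [B rB] := horner_le_exp szr.
exists (absz (A + B)) => k ltk.
have k_gt : A + B < k%:Z by apply: le_lt_trans (ler_norm _) _; rewrite -abszE ltz_nat.
have k1 : 1 <= k%:Z by rewrite lez_nat (leq_ltn_trans _ ltk).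
have k0 : 0 < k%:Z by apply: lt_le_trans k1.
rewrite -(ltr_pM2r k0).
have -> : q = a *: 'X^m + r by rewrite /r addrC subrK.
rewrite hornerD hornerZ hornerXn.
have : k%:Z ^+ m * k%:Z <= `|a * k%:Z ^+ m| * k%:Z.
  rewrite ler_wpM2r ?(ltW k0) // normrM normrX (gtr0_norm k0) ler_peMl ?exprn_ge0 ?(ltW k0) //.
  by rewrite -gtz0_ge1 normr_gt0 lead_coef_eq0.
move: (pA _ k1) (rB _ k1); set P := `|p.[_]|; set Q := `|a * _|; set S := `|r.[_]| => HP HS HQ.
apply: lt_le_trans (_ : (Q - S) * k%:Z <= _); last first.
  rewrite ler_wpM2r ?(ltW k0) // lerBlDr.
  by rewrite /Q -[X in `|X|](addrK r.[k%:Z]); exact: ler_normB.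
rewrite mulrBl ltrBrDr; apply: le_lt_trans (lerD HP HS) _.
by apply: lt_le_trans HQ; rewrite -mulrDl mulrC ltr_pM2l // exprn_gt0.
Qed.

Lemma size_horner_le (p q : {poly int}) :
  (forall k : nat, `|p.[k%:Z]| <= `|q.[k%:Z]|) -> (size p <= size q)%N.
Proof.
move=> pq; rewrite leqNgt; apply/negP => /eventually_ltr_horner[K /(_ K.+1 (ltnSn K))].
by rewrite ltNge pq.
Qed.

Lemma poly_dvd_of_horner_dvd (p q : {poly int}) : q \is monic ->
  (forall k : nat, (q.[k%:Z] %| p.[k%:Z])%Z) ->
  exists d : {poly int}, p = d * q.
Proof.
move=> q_mon q_dvd; exists (Pdiv.Ring.rdivp p q).
rewrite [LHS](Pdiv.RingMonic.rdivp_eq q_mon).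
set r := Pdiv.Ring.rmodp p q.
suff -> : r = 0 by rewrite addr0.
have [K rK] : exists K : nat, forall k : nat, (K < k)%N -> `|r.[k%:Z]| < `|q.[k%:Z]|.
  by apply: eventually_ltr_horner; rewrite Pdiv.Ring.ltn_rmodpN0 // monic_neq0.
have r0 (k : nat) : (K < k)%N -> r.[k%:Z] = 0.
  move=> /rK lt_rq; apply/eqP; apply: contraTT lt_rq => rk0; rewrite -leNgt.
  have : (q.[k%:Z] %| r.[k%:Z])%Z.
    have -> : r = p - Pdiv.Ring.rdivp p q * q.
      by rewrite [X in X - _](Pdiv.RingMonic.rdivp_eq q_mon p) addrC addKr.
    by rewrite hornerD hornerN hornerM rpredB // dvdz_mull.
  by rewrite dvdzE -!abszE lez_nat => /dvdn_leq; apply; rewrite absz_gt0.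
apply/eqP; rewrite -size_poly_eq0 -leqn0 -(size_poly0 int).
(* Translating by [K.+1] keeps the size and moves every natural argument beyond [K], where [r]
   vanishes. *)
rewrite -(size_comp_poly2 r (size_XaddC K.+1%:Z)).
apply: size_horner_le => k; rewrite horner_comp hornerD hornerX hornerC.
by rewrite r0 ?horner0 // addnS ltnS leq_addl.
Qed.

(** * Monicity of the chromatic polynomial *)

Lemma horner_falling (k n : nat) :
  (\prod_(i < n) ('X - i%:Z%:P)).[k%:Z] = (k ^_ n)%:Z.
Proof.
elim: n => [|n IHn]; first by rewrite big_ord0 hornerC.
rewrite big_ord_recr hornerM IHn !hornerE ffactnSr.
have [nk|kn] := leqP n k; first by rewrite PoszM subzn.
by rewrite ffact_small // mul0r.
Qed.

Lemma chromatic_poly_monic (T : finType) (G : graph T) :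
  chromatic_poly G \is monic.
Proof.
pose n := #|{: {x : T | x \in vertices G}}|.
set c := chromatic_poly G.
(* k^_n <= chi(G,k) <= k^n forces the difference with 'X^n to have degree < n. *)
pose F : {poly int} := \prod_(i < n) ('X - i%:Z%:P).
have FM : F \is monic by exact: monic_prod_XsubC.
have szF : size F = n.+1 by rewrite size_prod_XsubC [index_enum _]unlock -enumT size_enum_ord.
have szE : (size ('X^n - F)%R <= n)%N.
  apply/leq_sizeP => j; rewrite coefB coefXn leq_eqVlt => /orP[/eqP<-|nj].
    have := monicP FM; rewrite lead_coefE szF /= => ->.
    by rewrite eqxx subrr.
  by rewrite gtn_eqF // nth_default ?szF // subrr.
have cub (k : nat) : c.[k%:Z] <= k%:Z ^+ n.
  rewrite chromatic_polyE -[k%:Z]natz -natrX natz lez_nat.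
  by apply: leq_trans (max_card _) _; rewrite card_ffun card_ord.
(* Injective colourings are proper, since the two ends of an edge are distinct. *)
have clb (k : nat) : F.[k%:Z] <= c.[k%:Z].
  rewrite horner_falling chromatic_polyE lez_nat.
  rewrite -{1}[k]card_ord -card_inj_ffuns; apply: subset_leq_card.
  apply/subsetP => f; rewrite !inE => /injectiveP f_inj.
  apply/forallP => u; apply/forallP => v; apply/implyP => uv.
  rewrite (inj_eq f_inj); apply: contraTneq uv => ->.
  apply/negP => /edgesP/andP[_]; by rewrite setUid cards1.
(* At naturals, ['X^n - c] lies between 0 and ['X^n - F], so the size bound carries over. *)
have szD : (size ('X^n - c)%R <= n)%N.
  apply: leq_trans szE; apply: size_horner_le => k.
  rewrite !hornerD !hornerN hornerXn !ger0_norm ?subr_ge0 ?cub ?(le_trans (clb k)) //.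
  by rewrite lerD2l lerN2.
have -> : c = 'X^n - ('X^n - c) by rewrite opprB addrC subrK.
by rewrite monicE lead_coefDl ?lead_coefXn // size_polyN size_polyXn ltnS.
Qed.

(** * Extending partial injections to permutations *)

(** Correct the permutation found for the tail by the transposition of [sigma a] and [b]; by
    uniqueness it fixes all values already prescribed. *)
Lemma perm_extension (X : finType) (s : seq (X * X)) :
  uniq (unzip1 s) -> uniq (unzip2 s) ->
  exists sigma : {perm X}, forall z, z \in s -> sigma z.1 = z.2.
Proof.
elim: s => [_ _|[a b] s IHs /= /andP[a_s us1] /andP[b_s us2]]; first by exists 1%g.
have [sigma sE] := IHs us1 us2; exists (sigma * tperm (sigma a) b)%g => z.
rewrite inE => /predU1P[->|zs] /=; first by rewrite permM tpermL.
rewrite permM sE //; apply: tpermD.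
  apply: contraNneq a_s; rewrite -(sE z zs) => /perm_inj ->.
  exact: map_f.
by apply: contraNneq b_s => ->; exact: map_f.
Qed.

Lemma perm_extend_in (I X : finType) (D : {pred I}) (f g : I -> X) :
  {in D &, injective f} -> {in D &, injective g} ->
  exists sigma : {perm X}, {in D, forall i, sigma (f i) = g i}.
Proof.
move=> f_inj g_inj; pose s := [seq (f i, g i) | i <- enum D].
have [||sigma sE] := @perm_extension X s.
- rewrite /unzip1 -map_comp map_inj_in_uniq ?enum_uniq // => i j.
  by rewrite !mem_enum; exact: f_inj.
- rewrite /unzip2 -map_comp map_inj_in_uniq ?enum_uniq // => i j.
  by rewrite !mem_enum; exact: g_inj.
by exists sigma => i iD; apply: (sE (f i, g i)); apply: map_f; rewrite mem_enum.
Qed.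

(** * Paths through the complement of [H] *)

Section Graphs.
Variable T : finType.
Implicit Types (G H : graph T) (x y : T).

Lemma adj_sym G : symmetric (adj G).
Proof. by move=> x y; rewrite /adj setUC. Qed.

Lemma adj_neq G x y : adj G x y -> x != y.
Proof.
by move=> /edgesP/andP[_]; apply: contraTneq => ->; rewrite setUid cards1.
Qed.

Lemma adj_vertices G x y : adj G x y -> (x \in vertices G) && (y \in vertices G).
Proof. by move=> /edgesP/andP[/subsetP eG _]; rewrite !eG // !inE eqxx ?orbT. Qed.

Lemma subgraph_adj G H x y : subgraph H G -> adj H x y -> adj G x y.
Proof. by move=> /andP[_ /subsetP]; exact. Qed.

Lemma path_edge_sub x (p : seq T) e :
  e \in path_edges x p -> e \subset path_vertices x p.
Proof.
move=> /imsetP[[a b] /(nthP (x, x))[i]]; rewrite size_zip /= => /[dup] ilt.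
rewrite nth_zip_cond size_zip /= ilt => _ [<- <-] ->.
move: ilt; rewrite ltn_min => /andP[i1 i2].
rewrite subUset !sub1set !inE -!in_cons mem_nth //=.
by rewrite inE mem_nth ?orbT.
Qed.

(* An edge of H on a path meeting H only in x and y would join x to y, so for *)
(* nonadjacent x and y the edge condition of path_intersecting is automatic.  *)
Lemma path_intersecting_adj G H x y (p : seq T) : path_intersecting H G ->
  x \in vertices H -> y \in vertices H -> path_between G x y p ->
  x != y -> {in p, forall z, z \in vertices H -> z = y} -> adj H x y.
Proof.
move=> pi_HG xH yH xyp xy pH; apply/negPn/negP => nxy.
have [x_G _ /= /andP[x_p _] /eqP lastp] := and4P xyp.
have VE : vertices H :&: path_vertices x p = [set x; y].
  apply/setP => z; rewrite !inE; apply/andP/orP => [[zH /predU1P[->|zp]]|].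
  - by left.
  - by right; rewrite (pH z).
  case=> /eqP ->; rewrite ?eqxx //; split=> //.
  by rewrite -in_cons -lastp mem_last.
case: (pi_HG x y xH yH xy nxy); exists p; split=> //.
apply/setP => e; rewrite !inE; apply/negP => /andP[eH /path_edge_sub ep].
have /andP[eVH e2] := edgesP eH.
have : e \subset [set x; y] by rewrite -VE subsetI eVH.
rewrite subEproper => /predU1P[eE|/proper_card].
  by move: nxy; rewrite /adj -eE eH.
by rewrite (eqP e2) cards2 xy.
Qed.

(** Adjacency in [G - V(H)], kept on all of [T]; its components are represented by their [root]. *)
Definition outside G H : rel T :=
  fun x y => [&& x \notin vertices H, y \notin vertices H & adj G x y].

Lemma outside_connect_sym G H : connect_sym (outside G H).
Proof.
apply: sym_connect_sym => x y; rewrite /outside adj_sym.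
by case: (x \in _); case: (y \in _).
Qed.

(** Shorten a walk from [v1] to [v2] outside [H] to a path and add [u] and [w] at its ends: the
    result meets [H] only in [u] and [w]. *)
Lemma connect_attach_adj G H u w v1 v2 : path_intersecting H G ->
  u \in vertices H -> w \in vertices H -> u != w ->
  v1 \notin vertices H -> adj G u v1 -> adj G v2 w ->
  connect (outside G H) v1 v2 -> adj H u w.
Proof.
move=> pi_HG uH wH uw v1H uv1 v2w /connectP[p e_p v2E]; move: v2w; rewrite {}v2E.
case/shortenP: e_p => {}p e_p p_uniq _ v2w.
have pH : all (fun z => z \notin vertices H) (v1 :: p).
  rewrite /= v1H; elim: p v1 e_p {v1H uv1 p_uniq v2w} => //= z p IHp v.
  by move=> /andP[/and3P[_ -> _] /IHp].
apply: (path_intersecting_adj pi_HG uH wH (p := v1 :: rcons p w)) => //; last first.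
  move=> z; rewrite -rcons_cons mem_rcons inE => /predU1P[->//|/(allP pH)/negP//].
apply/and4P; split.
- by case/andP: (adj_vertices uv1).
- rewrite /= uv1 rcons_path v2w andbT.
  by apply: sub_path e_p => a b /and3P[].
- rewrite -rcons_cons cons_uniq rcons_uniq p_uniq mem_rcons inE negb_or uw !andbT /=.
  by apply/andP; split; apply/negP => /(allP pH); rewrite ?uH ?wH.
- by rewrite /= last_rcons.
Qed.

Lemma path_intersecting_induced G H x y : path_intersecting H G ->
  x \in vertices H -> y \in vertices H -> adj G x y -> adj H x y.
Proof.
move=> pi_HG xH yH xy.
apply: (path_intersecting_adj pi_HG xH yH (p := [:: y])); rewrite ?(adj_neq xy) //.
  have /andP[xG _] := adj_vertices xy.
  by rewrite /path_between xG /= xy inE (adj_neq xy) eqxx.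
by move=> z; rewrite inE => /eqP.
Qed.

Lemma proper_coloringsP G k (f : {ffun {x : T | x \in vertices G} -> 'I_k}) :
  reflect (forall u v, adj G (val u) (val v) -> f u != f v)
          (f \in proper_colorings G k).
Proof.
rewrite inE; apply: (iffP forallP) => [fG u v uv|fG u].
  by move/forallP: (fG u) => /(_ v)/implyP->.
by apply/forallP => v; apply/implyP => /fG.
Qed.

(** * Counting extensions of a colouring of [H] *)

Section Extensions.
Variables G H : graph T.
Hypothesis sub_HG : subgraph H G.

Let VG : finType := {x : T | x \in vertices G}.
Let VH : finType := {x : T | x \in vertices H}.

Lemma subgraph_vertices x : x \in vertices H -> x \in vertices G.
Proof. by case/andP: sub_HG => /subsetP/(_ x). Qed.

Definition vertex_incl (u : VH) : VG :=
  exist _ (val u) (subgraph_vertices (valP u)).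

Definition restriction (k : nat) (f : {ffun VG -> 'I_k}) : {ffun VH -> 'I_k} :=
  [ffun u => f (vertex_incl u)].

Definition extensions (k : nat) (c : {ffun VH -> 'I_k}) :=
  [set f in proper_colorings G k | restriction f == c].

Lemma restriction_proper k (f : {ffun VG -> 'I_k}) :
  f \in proper_colorings G k -> restriction f \in proper_colorings H k.
Proof.
move=> /proper_coloringsP fG; apply/proper_coloringsP => u v uv.
by rewrite !ffunE fG //=; exact: subgraph_adj uv.
Qed.

Hypothesis pi_HG : path_intersecting H G.

(* The component of r in G - H attaches to a clique of H, on which c and c'   *)
(* are injective; permuting the colours of each component accordingly turns   *)
(* an extension of c into one of c'.                                          *)
Lemma leq_card_extensions k (c c' : {ffun VH -> 'I_k}) :
  c \in proper_colorings H k -> c' \in proper_colorings H k ->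
  (#|extensions c| <= #|extensions c'|)%N.
Proof.
move=> /proper_coloringsP cH /proper_coloringsP c'H.
pose e := outside G H.
pose attached r : pred VH := fun u =>
  [exists v, [&& v \notin vertices H, adj G (val u) v & fingraph.root e v == r]].
have attached_clique r : {in attached r &, forall u w, u != w -> adj H (val u) (val w)}.
  move=> u w /existsP[v1 /and3P[v1H uv1 /eqP rv1]] /existsP[v2 /and3P[v2H wv2 /eqP rv2]] uw.
  apply: (connect_attach_adj pi_HG (valP u) (valP w) uw v1H uv1 (v2 := v2)).
    by rewrite adj_sym.
  by apply/(fingraph.rootP (outside_connect_sym G H)); rewrite -/e rv1.
have inj_attached r (d : {ffun VH -> 'I_k}) :
    (forall u v, adj H (val u) (val v) -> d u != d v) -> {in attached r &, injective d}.
  move=> dH u w ur wr /eqP; apply: contraTeq => uw; apply: dH.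
  exact: (attached_clique r).
have [sigma sigmaE] : exists sigma : T -> {perm 'I_k},
    forall r, {in attached r, forall u, sigma r (c u) = c' u}.
  apply: (@fin_all_exists T (fun=> {perm 'I_k})
    (fun r s => {in attached r, forall u, s (c u) = c' u})) => r.
  by apply: perm_extend_in; exact: inj_attached.
pose recolor (f : {ffun VG -> 'I_k}) : {ffun VG -> 'I_k} := [ffun v =>
  if insub (val v) is Some u then c' u else sigma (fingraph.root e (val v)) (f v)].
have recolor_in f v (u : VH) : val v = val u -> recolor f v = c' u.
  by rewrite ffunE => ->; rewrite valK.
have recolor_out f v : val v \notin vertices H ->
    recolor f v = sigma (fingraph.root e (val v)) (f v).
  by rewrite ffunE => vH; rewrite insubN.
have ext_in f d v (u : VH) : f \in @extensions k d -> val v = val u -> f v = d u.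
  rewrite inE => /andP[_ /eqP <-] vu; rewrite ffunE; congr (f _); exact: val_inj.
have recolor_inj : {in extensions c &, injective recolor}.
  move=> f g fc gc /ffunP fg; apply/ffunP => v.
  have [vH|vH] := boolP (val v \in vertices H).
    by rewrite !(ext_in _ c v (exist _ (val v) vH)).
  by have := fg v; rewrite !recolor_out // => /perm_inj.
rewrite -(card_in_imset recolor_inj); apply: subset_leq_card.
apply/subsetP => _ /imsetP[f fc ->].
have fG : forall u v, adj G (val u) (val v) -> f u != f v.
  by apply/proper_coloringsP; move: fc; rewrite inE => /andP[].
rewrite inE; apply/andP; split; last first.
  by apply/eqP/ffunP => u; rewrite ffunE; exact: recolor_in.
(* Here [u] is attached to the component of [v], whose permutation sends [c u] to [c' u]; both new
   colours are thus images of the old ones under one permutation. *)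
have mixed (u v : VG) : val u \in vertices H -> val v \notin vertices H ->
    adj G (val u) (val v) -> recolor f u != recolor f v.
  move=> uH vH uv; pose u' : VH := exist _ (val u) uH.
  rewrite (recolor_in f u u') // recolor_out // -(sigmaE (fingraph.root e (val v)) u').
    by rewrite (inj_eq perm_inj) -(ext_in f c u u') // fG.
  by apply/existsP; exists (val v); rewrite vH uv eqxx.
apply/proper_coloringsP => u v uv.
have [uH|uH] := boolP (val u \in vertices H); have [vH|vH] := boolP (val v \in vertices H).
- pose u' : VH := exist _ (val u) uH; pose v' : VH := exist _ (val v) vH.
  rewrite (recolor_in f u u') // (recolor_in f v v') //.
  by apply: c'H; exact: path_intersecting_induced uv.
- exact: mixed.
- by rewrite eq_sym mixed // adj_sym.
- rewrite !recolor_out //.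
  have -> : fingraph.root e (val u) = fingraph.root e (val v).
    apply/(fingraph.rootP (outside_connect_sym G H)); apply: connect1.
    by rewrite /outside uH vH.
  by rewrite (inj_eq perm_inj) fG.
Qed.

Lemma card_proper_colorings_dvd k :
  (#|proper_colorings H k| %| #|proper_colorings G k|)%N.
Proof.
(* If [H] has no proper [k]-colouring, neither has [G], and the claim is that 0 divides 0. *)
have [c0 c0H|noH] := pickP (mem (proper_colorings H k)); last first.
  rewrite [#|proper_colorings G k|]eq_card0 // => f.
  by apply/negP => /restriction_proper; rewrite -[_ \in _]/(mem _ _) noH.
suff -> : #|proper_colorings G k| = (#|proper_colorings H k| * #|extensions c0|)%N.
  exact: dvdn_mulr.
rewrite -sum1_card (partition_big (@restriction k) (mem (proper_colorings H k))) /=; last first.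
  by move=> f; exact: restriction_proper.
rewrite -sum_nat_const; apply: eq_bigr => c cH.
rewrite sum1dep_card -/(extensions c).
by apply/eqP; rewrite eqn_leq !leq_card_extensions.
Qed.

End Extensions.
End Graphs.

Theorem theorem2p12 (T : finType) (G H : graph T)
    (sub_HG : subgraph H G) (pi_HG : path_intersecting H G) :
  exists q : {poly int}, chromatic_poly G = q * chromatic_poly H.
Proof.
apply: poly_dvd_of_horner_dvd => [|k]; first exact: chromatic_poly_monic.
by rewrite !chromatic_polyE dvdzE /= card_proper_colorings_dvd.
Qed.
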